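(* Let $\Omega\subset\mathbb{R}^2$ be open, $\lambda>0$, and let $u\in L^2(\Omega)$ satisfy $-\Delta u=\lambda u$ in $\Omega$. Suppose $\Gamma^+,\Gamma^-\subset\Omega$ are two nodal lines of $u$ (line segments on which $u=0$) with $\Gamma^+\cap\Gamma^-=\{\mathbf{x}_0\}$, $\mathbf{x}_0\in\Omega$, forming at $\mathbf{x}_0$ the angle $\angle(\Gamma^+,\Gamma^-)=\alpha\cdot 2\pi$, where $\alpha\in(0,1)$ is irrational. Then $\mathrm{Vani}(u;\mathbf{x}_0)=+\infty$.
   Context: No boundary condition is imposed on $\partial\Omega$; $u$ is real-analytic in $\Omega$. Vanishing order: writing the Taylor expansion $u(\mathbf{x}_0+\mathbf{y})=\sum_{m\ge 0}P_m(\mathbf{y})$ with $P_m$ a homogeneous polynomial of degree $m$, $\mathrm{Vani}(u;\mathbf{x}_0)$ is the smallest $m$ with $P_m\not\equiv 0$, and $\mathrm{Vani}(u;\mathbf{x}_0)=+\infty$ if all $P_m\equiv 0$. *)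

(* Defs.v *)
From mathcomp Require Import all_boot all_order all_algebra.
From mathcomp Require Import all_classical all_reals all_analysis.
Import Order.TTheory GRing.Theory Num.Theory numFieldNormedType.Exports.

Set Implicit Arguments.
Unset Strict Implicit.
Unset Printing Implicit Defensive.

Local Open Scope ring_scope.
Local Open Scope classical_set_scope.

Section Defs.
Variable R : realType.

Definition e1 : R * R := (1, 0).
Definition e2 : R * R := (0, 1).

Definition laplacian (u : R * R -> R) (x : R * R) : R :=
  'D_e1 ('D_e1 u) x + 'D_e2 ('D_e2 u) x.

Definition C2_on (D : set (R * R)) (u : R * R -> R) : Prop :=
  forall x, D x ->
    {for x, continuous u} /\
        forall v, (v = e1 \/ v = e2) ->
          [/\ derivable u x v, {for x, continuous ('D_v u)} &
              forall w, (w = e1 \/ w = e2) ->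
                derivable ('D_v u) x w /\ {for x, continuous ('D_w ('D_v u))}].

Definition leb2 := ((@lebesgue_measure R) \x (@lebesgue_measure R))%E.

Definition in_L2 (D : set (R * R)) (u : R * R -> R) : Prop :=
  leb2.-integrable D (fun x => (u x ^+ 2)%:E).

(* Homogeneous term of degree m of the Taylor expansion of u at x0,
   evaluated at y:  P_m(y) = (1/m!) (d/dt)^m u(x0 + t y) |_{t=0}. *)
Definition taylor_hom (u : R * R -> R) (x0 : R * R) (m : nat) (y : R * R) : R :=
  (derive1n m (fun t : R => u (x0 + t *: y)) 0) / (m`!)%:R.

Definition Pm_nonzero (u : R * R -> R) (x0 : R * R) : pred nat :=
  fun m => `[< exists y, taylor_hom u x0 m y != 0 >].

Definition Vani (u : R * R -> R) (x0 : R * R) : \bar R :=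
  match pselect (exists m, Pm_nonzero u x0 m) with
  | left h => ((ex_minn h)%:R)%:E
  | right _ => +oo%E
  end.

Definition dir (th : R) : R * R := (cos th, sin th).

Definition segment_from (x0 : R * R) (th r : R) : set (R * R) :=
  [set x0 + t *: dir th | t in `[0, r]].


End Defs.

(* Main.v *)
(** The lowest-order nonzero homogeneous part of the Taylor expansion of [u] at
    [x0], of degree [n], is harmonic, hence equal to
    [r^n (A cos(n phi) + B sin(n phi))] in polar coordinates. It vanishes along
    two rays making the angle [2 pi alpha], so
    [(A, B)] is killed by a matrix of determinant [sin(2 pi n alpha)], which is
    nonzero as [alpha] is irrational.

    That [u], assumed only [C^2], has a Taylor expansion is proved without
    integration. The maximum principle with a quadratic barrier bounds the
    gradient at the centre of a square by a constant times the supremum of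
    [|u|]. Applied to the difference quotients of [u], which solve the same
    equation, and then to the differences of two of these, the bound shows that
    the difference quotients and their first and second derivatives converge
    locally uniformly; so every partial derivative of a solution is again a
    solution. *)
Require Import Defs.
From mathcomp Require Import all_boot all_order all_algebra.
From mathcomp Require Import all_classical all_reals all_analysis.
From mathcomp Require Import ring lra zify.
Import Order.TTheory GRing.Theory Num.Theory numFieldNormedType.Exports.
Local Open Scope ring_scope.
Local Open Scope classical_set_scope.
Set Implicit Arguments.
Unset Strict Implicit.
Unset Printing Implicit Defensive.

(** * One-variable calculus: difference quotients, extrema, mean value inequality *)

Section OneVariable.
Context {R : realType}.
Implicit Types g : R -> R.

Lemma is_derive_epsP (V : normedModType R) (f : V -> R) (a v : V) (l : R) :
  is_derive a v f l <->
  (forall e, 0 < e -> exists2 d, 0 < d &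
     forall h, h != 0 -> `|h| < d -> `|h^-1 * (f (h *: v + a) - f a) - l| < e).
Proof.
split=> [[df <-] e e0|H].
  have /cvgrPdist_lt/(_ e e0) : 
      (fun h => h^-1 *: ((f \o shift a) (h *: v) - f a)) @ 0^' --> 'D_v f a by [].
  move=> /nbhs_ballP[d /= d0 H]; exists d => // h h0 hd.
  rewrite distrC; apply: H => //.
  by rewrite /ball/= sub0r normrN.
have cv : (fun h => h^-1 *: ((f \o shift a) (h *: v) - f a)) @ 0^' --> l.
  apply/cvgrPdist_lt => e /H[d d0 {}H]; apply/nbhs_ballP; exists d => //= h.
  by rewrite /ball/= sub0r normrN => hd h0; rewrite distrC; apply: H.
by apply: DeriveDef; [apply/cvg_ex; exists l|exact/cvg_lim].
Qed.

(** The two difference quotients are the same expression, so the one-variable results apply along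
    any line. *)
Lemma is_derive_line (V : normedModType R) (f : V -> R) (a v : V) (t l : R) :
  is_derive (t *: v + a) v f l <-> is_derive t 1 (fun s => f (s *: v + a)) l.
Proof.
by split=> /is_derive_epsP H; apply/is_derive_epsP => e /H[d d0 {}H];
  exists d => // h h0 /(H h h0); rewrite [_ *: (1 : R)]mulr1 scalerDl addrA.
Qed.

Lemma is_derive_slice (V : normedModType R) (f : V -> R) (g : R -> R) (a v : V)
    (t l : R) :
  (forall s, g s = f (s *: v + a)) -> is_derive (t *: v + a) v f l ->
  is_derive t 1 g l.
Proof. by move=> /funext -> /is_derive_line. Qed.

Lemma is_derive_unique (V : normedModType R) (f : V -> R) (a v : V) (l k : R) :
  is_derive a v f l -> is_derive a v f k -> l = k.
Proof. by move=> [_ <-] [_ <-]. Qed.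

Lemma is_derive_ext (V : normedModType R) (f k : V -> R) (a v : V) (l m : R) :
  f =1 k -> l = m -> is_derive a v f l -> is_derive a v k m.
Proof. by move=> /funext -> ->. Qed.

Lemma derive_ge0_right g (c l r : R) : 0 < r ->
  is_derive c 1 g l -> (forall x, c < x < c + r -> g c <= g x) -> 0 <= l.
Proof.
move=> r0 /is_derive_epsP H gc; rewrite leNgt; apply/negP => l0.
have /H[d d0 {}H] : 0 < - l by rewrite oppr_gt0.
pose h := Num.min r d / 2.
have m0 : 0 < Num.min r d by rewrite lt_min r0.
have h0 : 0 < h by rewrite divr_gt0.
have hm : h < Num.min r d by rewrite /h ltr_pdivrMr//; lra.
move: (hm); rewrite lt_min => /andP[hr hd].
have /H : h != 0 by rewrite gt_eqF.
rewrite gtr0_norm// => /(_ hd); rewrite [_ *: (1:R)]mulr1 ltr_norml => /andP[_].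
suff : 0 <= h^-1 * (g (h + c) - g c) by lra.
rewrite mulr_ge0 ?invr_ge0 ?(ltW h0)// subr_ge0; apply: gc.
by apply/andP; split; lra.
Qed.

(** The vertex [x0] is an end of both nodal segments, so there [u] is known to vanish on one side
    only. As the two-sided derivative exists, one side determines it. *)
Lemma derive_eq0_right g (c l r : R) : 0 < r ->
  is_derive c 1 g l -> (forall x, c <= x < c + r -> g x = 0) -> l = 0.
Proof.
move=> r0 dg g0; apply/eqP; rewrite eq_le; apply/andP; split.
  rewrite -oppr_ge0; apply: (@derive_ge0_right (- g) c _ r) => // x /andP[cx xr].
  by rewrite !fctE !g0 ?lexx ?ltrDl ?r0 // (ltW cx).
apply: (derive_ge0_right r0 dg) => x /andP[cx xr].
by rewrite !g0 ?lexx ?ltrDl ?r0 // (ltW cx).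
Qed.

Lemma derive_continuous g (a b : R) (dg : R -> R) :
  (forall x, a <= x <= b -> is_derive x 1 g (dg x)) ->
  {within `[a, b], continuous g}.
Proof.
move=> H; apply: derivable_within_continuous => x; rewrite in_itv/= => /H.
by case.
Qed.

(** The endpoints come in either order because increments of both signs occur in the difference
    quotients below. *)
Lemma mvt_le g (dg : R -> R) (a b C : R) :
  (forall x, Num.min a b <= x <= Num.max a b -> is_derive x 1 g (dg x)) ->
  (forall x, Num.min a b <= x <= Num.max a b -> `|dg x| <= C) ->
  `|g b - g a| <= C * `|b - a|.
Proof.
wlog ab : a b / a <= b => [H|].
  have [/H //|] := boolP (a <= b); rewrite -ltNge => /ltW ba.
  by rewrite minC maxC distrC [in X in _ <= X]distrC; exact: H.
rewrite min_l// max_r// => dgP dgC.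
have [x xab ->] := MVT_segment ab (fun x xab => dgP x (subset_itv_oo_cc xab))
  (derive_continuous dgP).
by rewrite normrM ler_wpM2r//; apply: dgC; rewrite in_itv/= in xab.
Qed.

(** At the maximum [dg c = 0]. If [l] were positive, [dg] would be positive just to the right of
    [c], and the mean value theorem would give [g (c + h) > g c]. *)
Lemma max_second_derive_le0 g (dg : R -> R) (c r l : R) : 0 < r ->
  (forall x, `|x - c| < r -> is_derive x 1 g (dg x)) ->
  is_derive c 1 dg l -> (forall x, `|x - c| < r -> g x <= g c) -> l <= 0.
Proof.
move=> r0 dgP d2 gmax; rewrite leNgt; apply/negP => l0.
have dgc : dg c = 0.
  have dgc : is_derive c 1 g (dg c) by apply: dgP; rewrite subrr normr0.
  apply: (is_derive_unique dgc).
  have inI t : t \in `]c - r, c + r[%R -> `|t - c| < r.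
    by rewrite in_itv/= ltr_norml => ?; lra.
  apply: (@derive1_at_max _ g (c - r) (c + r)); first lra.
  - by move=> t /inI/dgP[].
  - by rewrite in_itv/=; lra.
  - by move=> t /inI/gmax.
move/is_derive_epsP/(_ _ l0) : d2 => [d d0 H].
have dgpos x : c < x < c + d -> 0 < dg x.
  move=> xcd; have xc0 : 0 < x - c by lra.
  have /H : x - c != 0 by rewrite gt_eqF.
  rewrite gtr0_norm// [_ *: (1:R)]mulr1 subrK dgc subr0.
  move=> /(_ ltac:(lra)); rewrite ltr_norml => /andP[+ _].
  rewrite ltrBrDl subrr pmulr_rgt0 ?invr_gt0//.
pose h := Num.min r d / 2.
have m0 : 0 < Num.min r d by rewrite lt_min r0.
have h0 : 0 < h by rewrite divr_gt0.
have hm : h < Num.min r d by rewrite /h ltr_pdivrMr//; lra.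
move: (hm); rewrite lt_min => /andP[hr hd].
have cch : c < c + h by lra.
have dgP' x : c <= x <= c + h -> is_derive x 1 g (dg x).
  by move=> ?; apply: dgP; rewrite ltr_norml; lra.
have [x xab E] := MVT cch (fun x xab => dgP' x (subset_itv_oo_cc xab))
  (derive_continuous dgP').
have : g (c + h) <= g c by apply: gmax; rewrite addrC addKr gtr0_norm.
rewrite -subr_le0 E addrAC subrr add0r leNgt mulr_gt0//.
by apply: dgpos; move: xab; rewrite in_itv/=; lra.
Qed.

End OneVariable.

(** * Gradient bound on a square by the maximum principle *)

Section GradientBound.
Context {R : realType}.
Implicit Types g k : R -> R.

Lemma is_derive_quadratic (a b c x : R) :
  is_derive x 1 (fun y => a + b * y + c * y ^+ 2) (b + 2 * c * x).
Proof.
apply/is_derive_epsP => e e0; exists (e / (1 + `|c|)).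
  by rewrite divr_gt0// ltr_pwDl.
move=> h h0; rewrite ltr_pdivlMr ?ltr_pwDl// => he.
rewrite [_ *: (1 : R)]mulr1.
rewrite [X in `|X|](_ : _ = c * h); last by field.
rewrite normrM; apply: le_lt_trans he.
by rewrite mulrC ler_wpM2l// lerDr.
Qed.

Lemma is_derive_reflect g (x l : R) :
  is_derive (- x) 1 g l -> is_derive x 1 (fun y => g (- y)) (- l).
Proof.
move=> /is_derive_epsP H; apply/is_derive_epsP => e /H[d d0 {}H].
exists d => // h h0 hd; have := H (- h); rewrite oppr_eq0 normrN => /(_ h0 hd).
rewrite ![_ *: (1 : R)]mulr1 opprD; set u := g _; set v := g _.
by rewrite -normrN => /le_lt_trans; apply; rewrite invrN mulNr !opprD !opprK.
Qed.

Lemma is_derive_half_diff g k q (x l m n : R) :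
  is_derive x 1 g l -> is_derive x 1 k m -> is_derive x 1 q n ->
  is_derive x 1 (fun y => (g y - k y) / 2 - q y) ((l - m) / 2 - n).
Proof.
move=> dg dk dq.
have := is_deriveB (is_deriveZ 2^-1 (is_deriveB dg dk)) dq.
rewrite [_ *: _]mulrC; apply: is_derive_ext => [y|].
  by rewrite mulrC.
by rewrite mulrC.
Qed.

(* The difference of the part of [F] odd in its second variable and a quadratic
   barrier is strictly subharmonic, hence has no positive interior maximum
   (Gilbarg-Trudinger, Section 3.4). *)
Lemma gradient_upper_bound (F : R * R -> R) (F1 F11 F2 F22 : R -> R -> R)
    (d M N : R) : 0 < d ->
  (forall s t : R, `|s| <= d -> `|t| <= d -> {for (s, t), continuous F}) ->
  (forall s t : R, `|s| <= d -> `|t| <= d ->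
     [/\ is_derive s 1 (fun x => F (x, t)) (F1 s t),
         is_derive s 1 (F1 ^~ t) (F11 s t),
         is_derive t 1 (fun x => F (s, x)) (F2 s t) &
         is_derive t 1 (F2 s) (F22 s t)]) ->
  (forall s t : R, `|s| <= d -> `|t| <= d -> `|F (s, t)| <= M) ->
  (forall s t : R, `|s| <= d -> `|t| <= d -> `|F11 s t + F22 s t| < N) ->
  F2 0 0 <= 2 * M / d + N * d / 2.
Proof.
move=> d0 cF dF FM FN.
have M0 : 0 <= M.
  by apply: le_trans (normr_ge0 _) (FM 0 0 _ _); rewrite normr0 ltW.
have N0 : 0 <= N.
  by apply: ltW; apply: le_lt_trans (normr_ge0 _) (FN 0 0 _ _); rewrite normr0 ltW.
pose a := M / d ^+ 2.
have a0 : 0 <= a by rewrite divr_ge0// sqr_ge0.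
have ad2 : a * d ^+ 2 = M by rewrite /a divfK// expf_eq0/= gt_eqF.
(* The barrier has Laplacian [- N], is nonnegative on [A] and at least [M] on the sides [|s| = d]
   and [t = d]. Its [t]-slope at the origin, [2 * a * d + N * d / 2], is the bound to be proved. *)
pose B (s t : R) := a * s ^+ 2 + a * (t * (2 * d - t)) + N / 2 * (t * (d - t)).
pose G (z : R * R) := (F z - F (z.1, - z.2)) / 2 - B z.1 z.2.
pose A := (`[- d, d] `*` `[0, d])%classic : set (R * R).
have cG : {within A, continuous G}.
  apply: continuous_in_subspaceT => -[s t]; rewrite inE/= /A => -[/=].
  rewrite !in_itv/= => sd td.
  have s_d : `|s| <= d by rewrite ler_norml; lra.
  have t_d : `|t| <= d by rewrite ler_norml; lra.
  have Nt_d : `|- t| <= d by rewrite normrN.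
  have cs : {for (s, t), continuous (fun z : R * R => z.1)} by exact: cvg_fst.
  have ct : {for (s, t), continuous (fun z : R * R => z.2)} by exact: cvg_snd.
  have cnt : {for (s, t), continuous (fun z : R * R => - z.2)}.
    by apply: continuousN.
  rewrite /G; apply: (@continuousB _ _ _ (fun z : R * R => (F z - F (z.1, - z.2)) / 2)
    (fun z : R * R => B z.1 z.2)).
    apply: continuousM; last exact: cvg_cst.
    apply: (@continuousB _ _ _ F (fun z => F (z.1, - z.2))); first exact: cF.
    apply: (@continuous_comp _ _ _ (fun z : R * R => (z.1, - z.2)) F); last exact: cF.
    exact: (cvg_pair cs cnt).
  rewrite /B; apply: continuousD; first apply: continuousD.
  - by apply: continuousM; [exact: cvg_cst|apply: continuousM].
  - apply: continuousM; [exact: cvg_cst|apply: continuousM => //].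
    by apply: continuousB => //; exact: cvg_cst.
  - apply: continuousM; [exact: cvg_cst|apply: continuousM => //].
    by apply: continuousB => //; exact: cvg_cst.
have A0 : A !=set0.
  by exists (0, 0); split=> /=; rewrite in_itv/=; apply/andP; split; lra.
have cA : compact A by apply: compact_setX; exact: segment_compact.
have [[s0 t0] + Gmax] := compact_EVT_max A0 cA cG.
rewrite inE => -[/=]; rewrite !in_itv/= => s0d t0d.
have {}Gmax s t : - d <= s <= d -> 0 <= t <= d -> G (s, t) <= G (s0, t0).
  by move=> sd td; apply: Gmax; rewrite inE; split; rewrite /= in_itv.
have s0_d : `|s0| <= d by rewrite ler_norml; lra.
have t0_d : `|t0| <= d by rewrite ler_norml; lra.
(* A positive maximum cannot lie on the boundary: the odd part vanishes on [t = 0], and on the other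
   three sides it is at most [M <= B]. So it is interior, and both pure second derivatives are
   nonpositive there. *)
have Gneg : G (s0, t0) <= 0.
  rewrite leNgt; apply/negP => Gpos.
  have Fb := FM s0 t0 s0_d t0_d.
  have Fb' : `|F (s0, - t0)| <= M by apply: FM => //; rewrite normrN.
  have ht : 0 <= t0 * (2 * d - t0) by apply: mulr_ge0; lra.
  have ht' : 0 <= t0 * (d - t0) by apply: mulr_ge0; lra.
  have as0 : 0 <= a * s0 ^+ 2 by rewrite mulr_ge0// sqr_ge0.
  have aht := mulr_ge0 a0 ht.
  have Nht' : 0 <= N / 2 * (t0 * (d - t0)) by rewrite mulr_ge0// divr_ge0.
  have GM : G (s0, t0) <= M - B s0 t0.
    rewrite /G /= lerD2r; move: Fb Fb'; rewrite !ler_norml => ? ?; lra.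
  have t0_gt0 : 0 < t0.
    rewrite lt_neqAle eq_sym; apply/andP; split; last lra.
    apply/eqP => t00; move: Gpos; rewrite /G /= t00 oppr0 subrr mul0r sub0r.
    by rewrite /B; move: as0; lra.
  have t0_lt : t0 < d.
    rewrite lt_neqAle; apply/andP; split; last lra.
    apply/eqP => t0E; suff : M <= B s0 t0 by lra.
    rewrite /B t0E -ad2; have -> : a * (d * (2 * d - d)) = a * d ^+ 2 by ring.
    by rewrite subrr !mulr0; lra.
  have s0_lt : `|s0| < d.
    rewrite lt_neqAle s0_d andbT; apply/eqP => s0E.
    suff : M <= B s0 t0 by lra.
    by rewrite /B -real_normK ?num_real// s0E ad2; lra.
  have Nt0_d : `|- t0| <= d by rewrite normrN.
  case: (dF s0 t0 s0_d t0_d) (dF s0 (- t0) s0_d Nt0_d) => d1 d11 d2 d22 [d1' d11' d2' d22'].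
  have near_s s : `|s - s0| < d - `|s0| -> `|s| <= d.
    move=> ss; rewrite -(subrK s0 s) (le_trans (ler_normD _ _))//; lra.
  pose r := Num.min t0 (d - t0).
  have r0 : 0 < r by rewrite lt_min; apply/andP; split; lra.
  have near_t t : `|t - t0| < r -> 0 <= t <= d.
    rewrite lt_min !ltr_norml; lra.
  have ts t : 0 <= t <= d -> `|t| <= d by rewrite ler_norml; lra.
  have Hs : (F11 s0 t0 - F11 s0 (- t0)) / 2 - (0 + 2 * a * 1) <= 0.
    apply: (@max_second_derive_le0 _ (fun s => G (s, t0))
      (fun s => (F1 s t0 - F1 s (- t0)) / 2 - (0 + 2 * a * s)) s0 (d - `|s0|)).
    - by rewrite subr_gt0.
    - move=> s /near_s sd.
      case: (dF s t0 sd t0_d) (dF s (- t0) sd Nt0_d) => e1 _ _ _ [e2 _ _ _].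
      apply: (@is_derive_half_diff _ _ (fun x => B x t0) _ _ _ _ e1 e2).
      have := is_derive_quadratic (a * (t0 * (2 * d - t0)) + N / 2 * (t0 * (d - t0))) 0 a s.
      by apply: is_derive_ext => // y; rewrite /B/=; ring.
    - exact: is_derive_half_diff.
    - by move=> s /near_s; rewrite ler_norml => sd; apply: Gmax.
  have Ht : (F22 s0 t0 - F22 s0 (- t0)) / 2 - (- 2 * a - N) <= 0.
    apply: (@max_second_derive_le0 _ (fun t => G (s0, t))
      (fun t => (F2 s0 t - (- F2 s0 (- t))) / 2 -
        ((2 * a * d + N * d / 2) + 2 * (- a - N / 2) * t)) t0 r) => //.
    - move=> t /near_t/ts td; have Ntd : `|- t| <= d by rewrite normrN.
      case: (dF s0 t s0_d td) (dF s0 (- t) s0_d Ntd) => _ _ e1 _ [_ _ e2 _].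
      apply: (@is_derive_half_diff _ _ (B s0) _ _ _ _ e1 (is_derive_reflect e2)).
      have := is_derive_quadratic (a * s0 ^+ 2) (2 * a * d + N * d / 2) (- a - N / 2) t.
      by apply: is_derive_ext => // y; rewrite /B/=; field.
    - apply: is_derive_half_diff => //.
        have := is_deriveN (is_derive_reflect d22'); rewrite opprK.
        exact.
      by apply: is_derive_ext (is_derive_quadratic (2 * a * d + N * d / 2)
        (2 * (- a - N / 2)) 0 t0) => [y|]; field.
    - by move=> t /near_t td; apply: Gmax => //; move: s0_d; rewrite ler_norml.
  (* In the sum of [Hs] and [Ht] the terms in [a] cancel, leaving the Laplacian of the odd part at
     most [- N], whereas [FN] makes it strictly larger. *)
  have := FN s0 t0 s0_d t0_d; have := FN s0 (- t0) s0_d Nt0_d.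
  by rewrite !ltr_norml => /andP[? ?] /andP[? ?]; lra.
have d00 : `|0 : R| <= d by rewrite normr0 ltW.
case: (dF 0 0 d00 d00) => _ _ d2 _.
pose C := 2 * M / d + N * d / 2.
have CE : C = 2 * a * d + N * d / 2.
  by rewrite /C -ad2; congr (_ + _); field; rewrite gt_eqF.
have dG : is_derive (0 : R) 1 (fun t => G (0, t))
    ((F2 0 0 - (- F2 0 0)) / 2 - (C + 2 * (- a - N / 2) * 0)).
  have d2' : is_derive (0 : R) 1 (fun y => F (0, - y)) (- F2 0 0).
    by apply: (@is_derive_reflect (fun y => F (0, y))); rewrite oppr0.
  apply: (@is_derive_half_diff _ _ (fun y => B 0 y)) => //.
  have := is_derive_quadratic 0 C (- a - N / 2) 0.
  by apply: is_derive_ext => // y; rewrite CE /B/=; field.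
(* The function [- G (0, t)] is zero at [t = 0] and nonnegative on its right, so its derivative
   [C - F2 0 0] is nonnegative. *)
have {}d2 : is_derive (0 : R) 1 (fun t => - G (0, t)) (C - F2 0 0).
  by have := is_deriveN dG; apply: is_derive_ext => //; field.
rewrite -/C -subr_ge0; apply: (derive_ge0_right d0 d2) => t; rewrite add0r => td.
rewrite lerN2 (le_trans (Gmax 0 t _ _))//; [lra|lra|].
rewrite (le_trans Gneg)// /G /B/= oppr0 subrr.
by rewrite expr0n/= !mul0r !mulr0 !addr0 subrr.
Qed.

Lemma gradient_bound (F : R * R -> R) (F1 F11 F2 F22 : R -> R -> R)
    (d M N : R) : 0 < d ->
  (forall s t : R, `|s| <= d -> `|t| <= d -> {for (s, t), continuous F}) ->
  (forall s t : R, `|s| <= d -> `|t| <= d ->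
     [/\ is_derive s 1 (fun x => F (x, t)) (F1 s t),
         is_derive s 1 (F1 ^~ t) (F11 s t),
         is_derive t 1 (fun x => F (s, x)) (F2 s t) &
         is_derive t 1 (F2 s) (F22 s t)]) ->
  (forall s t : R, `|s| <= d -> `|t| <= d -> `|F (s, t)| <= M) ->
  (forall s t : R, `|s| <= d -> `|t| <= d -> `|F11 s t + F22 s t| < N) ->
  `|F2 0 0| <= 2 * M / d + N * d / 2.
Proof.
move=> d0 cF dF FM FN; rewrite ler_norml; apply/andP; split.
  rewrite lerNl; apply: (@gradient_upper_bound (fun z => - F z)
    (fun s t => - F1 s t) (fun s t => - F11 s t)
    (fun s t => - F2 s t) (fun s t => - F22 s t)) => //.
  - by move=> s t sd td; apply: continuousN; exact: cF.
  - by move=> s t sd td; have [? ? ? ?] := dF s t sd td; split; exact: is_deriveN.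
  - by move=> s t sd td; rewrite normrN FM.
  - by move=> s t sd td; rewrite -opprD normrN FN.
exact: (@gradient_upper_bound F F1 F11 F2 F22).
Qed.

End GradientBound.

(** * Limits of sequences of functions and of their derivatives *)

Section UniformLimits.
Context {R : realType}.

Lemma cvg_norm_le (u delta : nat -> R) (l c a : R) :
  u @ \oo --> l -> delta @ \oo --> 0 ->
  (forall n, `|u n - c| <= a + delta n) -> `|l - c| <= a.
Proof.
move=> ul d0 uc; apply/ler_addgt0Pr => e e0.
have e2 : 0 < e / 2 by rewrite divr_gt0.
near \oo => n.
have Hu : `|l - u n| < e / 2.
  by near: n; move/cvgrPdist_lt : ul; apply.
have Hd : `|0 - delta n| < e / 2.
  by near: n; move/cvgrPdist_lt : d0; apply.
have := ler_normD (l - u n) (u n - c); rewrite addrA subrK => /le_trans; apply.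
have := uc n; have := ler_norm (delta n).
rewrite sub0r normrN in Hd; lra.
Unshelve. all: by end_near. Qed.

(** Letting [m] tend to infinity in the Cauchy bound leaves [delta n] alone, which is why the error
    is split as [delta n + delta m]. *)
Lemma cauchy_bound_cvg (u delta : nat -> R) :
  delta @ \oo --> 0 ->
  (forall n m, `|u n - u m| <= delta n + delta m) ->
  exists2 l, u @ \oo --> l & forall n, `|u n - l| <= delta n.
Proof.
move=> d0 uc.
have /cvg_ex[l ul] : cvg (u @ \oo).
  apply/cauchy_cvgP/cauchy_exP => e e0.
  have e2 : 0 < e / 2 by rewrite divr_gt0.
  move/cvgrPdist_lt : d0 => /(_ _ e2) [N _ H].
  exists (u N); exists N => // n /= Nn; rewrite /ball/=.
  apply: le_lt_trans (uc N n) _; have := H n Nn; have := H N (leqnn N).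
  rewrite /= !sub0r !normrN.
  have := ler_norm (delta n); have := ler_norm (delta N); lra.
by exists l => // n; rewrite distrC; apply: (cvg_norm_le ul d0) => m;
  rewrite distrC.
Qed.

(** The mean value inequality for [g_ m - g_ N], followed by [m] tending to infinity, compares the
    difference quotients of [g] and [g_ N] within [delta N], uniformly in the increment. The limits
    in the index and in the increment can then be exchanged. *)
Lemma derive_lim (g_ dg_ : nat -> R -> R) (g : R -> R) (delta : nat -> R) (r : R) :
  0 < r -> delta @ \oo --> 0 ->
  (forall n (t : R), `|t| < r -> is_derive t 1 (g_ n) (dg_ n t)) ->
  (forall n m t, `|t| < r -> `|dg_ n t - dg_ m t| <= delta n + delta m) ->
  (forall t, `|t| < r -> g_ n t @[n --> \oo] --> g t) ->
  exists2 l, dg_ n 0 @[n --> \oo] --> l & is_derive (0 : R) 1 g l.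
Proof.
move=> r0 d0 dgP dgC gcvg.
have r00 : `|0 : R| < r by rewrite normr0.
have [l dgl dl] := cauchy_bound_cvg d0 (fun n m => dgC n m 0 r00).
exists l => //; apply/is_derive_epsP => e e0.
have e3 : 0 < e / 3 by rewrite divr_gt0.
move/cvgrPdist_lt : (d0) => /(_ _ e3) [N _ /(_ N (leqnn N))/=].
rewrite sub0r normrN => dN.
have /is_derive_epsP/(_ _ e3)[d dpos Hd] := dgP N 0 r00.
exists (Num.min d r); first by rewrite lt_min dpos.
move=> h h0; rewrite lt_min => /andP[hd hr].
have := Hd h h0 hd; rewrite [_ *: (1 : R)]mulr1 addr0 => HN.
have Hg : `|h^-1 * (g h - g 0) - h^-1 * (g_ N h - g_ N 0)| <= delta N.
  apply: (@cvg_norm_le (fun m => h^-1 * (g_ m h - g_ m 0)) delta) => //.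
    apply: cvgM; [exact: cvg_cst|apply: cvgB; exact: gcvg].
  move=> m; rewrite -mulrBr normrM normfV mulrC ler_pdivrMr ?normr_gt0//.
  rewrite opprB [X in `|X|](_ : _ = (g_ m h - g_ N h) - (g_ m 0 - g_ N 0)); last by ring.
  have seg x : Num.min 0 h <= x <= Num.max 0 h -> `|x| < r.
    case: (leP 0 h) => h0' /andP[x1 x2]; move: hr; rewrite !ltr_norml; lra.
  have := @mvt_le R (fun t => g_ m t - g_ N t) (fun t => dg_ m t - dg_ N t)
    0 h (delta N + delta m).
  rewrite subr0; apply.
    by move=> x /seg xr; apply: is_deriveB; exact: dgP.
  by move=> x /seg xr; rewrite [leRHS]addrC; exact: dgC.
have := ler_norm (delta N).
have := dl N.
rewrite [X in `|X| < e](_ : _ = (h^-1 * (g h - g 0) - h^-1 * (g_ N h - g_ N 0))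
  + (h^-1 * (g_ N h - g_ N 0) - dg_ N 0) + (dg_ N 0 - l)); last by ring.
set A := _ - _ in Hg *; set B := _ - _ in HN *; set C := _ - l.
have := ler_normD (A + B) C; have := ler_normD A B; lra.
Qed.

Lemma derive_le_lipschitz (V : normedModType R) (f : V -> R) (a v : V) (l r C : R) :
  0 < r -> is_derive a v f l ->
  (forall h, `|h| <= r -> `|f (h *: v + a) - f a| <= `|h| * C) -> `|l| <= C.
Proof.
move=> r0 /is_derive_epsP H fC; apply/ler_addgt0Pr => e /H[d d0 {}H].
pose h := Num.min r d / 2.
have m0 : 0 < Num.min r d by rewrite lt_min r0.
have h0 : 0 < h by rewrite divr_gt0.
have hm : h < Num.min r d by rewrite /h ltr_pdivrMr//; lra.
move: (hm); rewrite lt_min => /andP[hr hd].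
have /H : h != 0 by rewrite gt_eqF.
rewrite gtr0_norm// => /(_ hd); set q := _ * _ => Hq.
have qC : `|q| <= C.
  rewrite normrM normfV mulrC ler_pdivrMr ?normr_gt0 ?gt_eqF// mulrC.
  by apply: fC; rewrite gtr0_norm// ltW.
have := ler_distD q l 0; rewrite !subr0 distrC; lra.
Qed.

Lemma continuous_uniform_limit (T : topologicalType) (f_ : nat -> T -> R) (f : T -> R)
    (eps : nat -> R) (D : set T) (x : T) :
  open D -> D x -> eps @ \oo --> 0 ->
  (forall n y, D y -> `|f_ n y - f y| <= eps n) ->
  (forall n, {for x, continuous (f_ n)}) -> {for x, continuous f}.
Proof.
move=> oD Dx e0 fe fc; apply/cvgrPdist_lt => e egt0.
have e3 : 0 < e / 3 by rewrite divr_gt0.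
move/cvgrPdist_lt : e0 => /(_ _ e3) [N _ /(_ N (leqnn N))/=].
rewrite sub0r normrN => eN.
have /cvgrPdist_lt/(_ _ e3) := fc N; apply: filterS2 (open_nbhs_nbhs (conj oD Dx)) => y Dy Hy.
have := fe N y Dy; have := fe N x Dx; have := ler_norm (eps N).
have := ler_distD (f_ N x) (f x) (f y); have := ler_distD (f_ N y) (f_ N x) (f y).
rewrite [`|f x - f_ N x|]distrC; lra.
Qed.

End UniformLimits.

(** * The Helmholtz equation: interior estimates for first and second derivatives *)

Section Helmholtz.
Context {R : realType}.
Variable lam : R.
Hypothesis lam_gt0 : 0 < lam.
Implicit Types (D : set (R * R)) (f g : R * R -> R) (p x y : R * R).

(** With directions indexed by booleans, [~~ b] is the other axis, and each estimate is proved once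
    for both. *)
Definition basis (b : bool) : R * R := if b then e1 R else e2 R.
Local Notation E := basis.

Definition partial (b : bool) f x : R := 'D_(E b) f x.

(* Unlike [C2_on], this asks nothing of the mixed derivatives nor of the
   continuity of the second ones, which makes it stable under uniform limits. *)
Definition helmholtz D f := forall x, D x ->
  [/\ {for x, continuous f},
      forall b, derivable f x (E b) /\ derivable (partial b f) x (E b) &
      - (partial true (partial true f) x + partial false (partial false f) x)
        = lam * f x].

Lemma is_derive_partial f b x :
  derivable f x (E b) -> is_derive x (E b) f (partial b f x).
Proof. exact: derivableP. Qed.

Lemma partial_val f b x (l : R) : is_derive x (E b) f l -> partial b f x = l.
Proof. by case. Qed.

Lemma partial_translate f y b :
  partial b (fun x => f (x + y)) = (fun x => partial b f (x + y)).
Proof.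
apply/funext => x; rewrite /partial /derive.
suff -> : (fun h => h^-1 *: (((fun z => f (z + y)) \o shift x) (h *: E b) - f (x + y)))
  = (fun h => h^-1 *: ((f \o shift (x + y)) (h *: E b) - f (x + y))) by [].
by apply/funext => h; rewrite /= addrA.
Qed.

Lemma eq_partial D f g b x : open D -> D x ->
  (forall y, D y -> f y = g y) -> partial b f x = partial b g x.
Proof.
by move=> oD Dx fg; apply: near_eq_derive; apply: filterS (open_nbhs_nbhs (conj oD Dx)).
Qed.

Lemma C2_helmholtz D f : C2_on D f ->
  (forall x, D x -> - laplacian f x = lam * f x) -> helmholtz D f.
Proof.
move=> C2 eqn x Dx; have [cf H] := C2 x Dx; split=> //; last exact: eqn.
have Eb b : E b = e1 R \/ E b = e2 R by case: b; [left|right].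
by move=> b; have [df _ /(_ _ (Eb b))[]] := H _ (Eb b).
Qed.

(* Keeps the unifier from comparing the reals in [e1] and [e2], which diverges. *)
Opaque partial.

Lemma helmholtz_sub D D' f : D' `<=` D -> helmholtz D f -> helmholtz D' f.
Proof. by move=> DD' H x /DD'/H. Qed.

Lemma helmholtz_eq D f x b : helmholtz D f -> D x ->
  partial (~~ b) (partial (~~ b) f) x + partial b (partial b f) x = - (lam * f x).
Proof.
have key (u v w : R) : - (u + v) = w -> u + v = - w /\ v + u = - w.
  by move=> <-; rewrite opprK [v + u]addrC.
move=> hf /hf[_ _ /key[k1 k2]]; case: b; [exact: k2|exact: k1].
Qed.

Lemma norm_basis b : `|E b| = 1.
Proof.
by case: b; rewrite prod_normE/= normr0 normr1; [rewrite max_l|rewrite max_r]; rewrite ?ler01.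
Qed.

(** The norm of [R * R] is the maximum norm, so closed balls are exactly the squares of
    [gradient_bound]. *)
Lemma norm_basis_lin b s t :
  `|s *: E (~~ b) + t *: E b| = Num.max `|s| `|t|.
Proof.
by case: b; rewrite prod_normE/= ![_ *: (1 : R)]mulr1 ![_ *: (0 : R)]mulr0
  add0r addr0 // maxC.
Qed.

Lemma open_cball D x : open D -> D x ->
  exists2 r, 0 < r & forall y, `|y - x| <= r -> D y.
Proof.
move=> oD Dx; have /nbhs_ballP[d /= d0 H] := open_nbhs_nbhs (conj oD Dx).
exists (d / 2); first by rewrite divr_gt0.
move=> y xy; apply: H; rewrite -ball_normE/= distrC (le_lt_trans xy)//; lra.
Qed.

Definition oball p r : set (R * R) := [set x | `|x - p| < r].

Lemma open_oball p r : open (oball p r).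
Proof.
rewrite (_ : oball p r = ball p r); first exact: ball_open.
by apply/seteqP; split=> x; rewrite -ball_normE/= /oball/= distrC.
Qed.

Lemma bounded_on_cball f p r : 0 <= r ->
  (forall x, `|x - p| <= r -> {for x, continuous f}) ->
  exists M, forall x, `|x - p| <= r -> `|f x| <= M.
Proof.
move=> r0 cf.
pose A := (`[p.1 - r, p.1 + r] `*` `[p.2 - r, p.2 + r])%classic : set (R * R).
have AE x : A x <-> `|x - p| <= r.
  rewrite /A/= !in_itv/= prod_normE/= ge_max !ler_distl.
  by split=> [[-> ->]|/andP[]].
have A0 : A !=set0 by exists p; apply/AE; rewrite subrr normr0.
have cA : compact A by apply: compact_setX; exact: segment_compact.
have [c _ H] : exists2 c, c \in A & forall t, t \in A -> `|f t| <= `|f c|.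
  apply: (@compact_EVT_max _ _ (fun x => `|f x|)) => //.
  apply: continuous_in_subspaceT => x; rewrite inE => /AE/cf cfx.
  exact: (continuous_comp cfx (@norm_continuous _ _ (f x))).
by exists `|f c| => x /AE Ax; apply: H; rewrite inE.
Qed.

(** The factor of [M] in the bound [2 * M / r + N * r / 2] once [N = lam * M], which bounds the
    Laplacian of a solution. *)
Definition grad_cst (r : R) := 2 / r + lam * r / 2.

Lemma interior_gradient D f p r M b : 0 < r ->
  (forall x, `|x - p| <= r -> D x) -> helmholtz D f ->
  (forall x, `|x - p| <= r -> `|f x| <= M) ->
  `|partial b f p| <= grad_cst r * M.
Proof.
move=> r0 pD hf fM; apply/ler_addgt0Pr => e e0.
(* Coordinates centred at [p] with [E b] as second axis, so that [F2 0 0] is [partial b f p]. *)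
pose z (s t : R) := s *: E (~~ b) + t *: E b + p.
have zr s t : `|s| <= r -> `|t| <= r -> `|z s t - p| <= r.
  by move=> sr tr; rewrite /z addrK norm_basis_lin ge_max sr.
have zE s t : t *: E b + (s *: E (~~ b) + p) = z s t.
  by rewrite /z addrA [_ + s *: _]addrC.
have zE' s t : s *: E (~~ b) + (t *: E b + p) = z s t by rewrite addrA.
(* The bound on the Laplacian has to be strict, hence [N = lam * M + 2 * e / r]; the excess adds
   exactly [e] to the gradient bound. *)
have e' : 0 < 2 * e / r by rewrite divr_gt0// mulr_gt0.
have := @gradient_bound R (fun u => f (z u.1 u.2))
  (fun s t => partial (~~ b) f (z s t))
  (fun s t => partial (~~ b) (partial (~~ b) f) (z s t))
  (fun s t => partial b f (z s t))
  (fun s t => partial b (partial b f) (z s t)) r M (lam * M + 2 * e / r) r0.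
rewrite /= (_ : z 0 0 = p); last by rewrite /z !scale0r !add0r.
have -> : 2 * M / r + (lam * M + 2 * e / r) * r / 2 = grad_cst r * M + e.
  by rewrite /grad_cst; field; rewrite gt_eqF.
apply.
- move=> s t sr tr; have [cf _ _] := hf _ (pD _ (zr s t sr tr)).
  apply: (@continuous_comp _ _ _ (fun u : R * R => z u.1 u.2) f (s, t)) => //.
  apply: cvgD; last exact: cvg_cst.
  by apply: cvgD; apply: cvgZr_tmp; [exact: cvg_fst|exact: cvg_snd].
- move=> s t sr tr; have [_ df _] := hf _ (pD _ (zr s t sr tr)).
  have [d1 d11] := df (~~ b); have [d2 d22] := df b.
  split.
  + apply: (@is_derive_slice _ _ f _ (t *: E b + p) (E (~~ b))) => [x|];
      rewrite zE' //; exact: is_derive_partial.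
  + apply: (@is_derive_slice _ _ (partial (~~ b) f) _ (t *: E b + p) (E (~~ b))) => [x|];
      rewrite zE' //; exact: is_derive_partial.
  + apply: (@is_derive_slice _ _ f _ (s *: E (~~ b) + p) (E b)) => [x|];
      rewrite zE //; exact: is_derive_partial.
  + apply: (@is_derive_slice _ _ (partial b f) _ (s *: E (~~ b) + p) (E b)) => [x|];
      rewrite zE //; exact: is_derive_partial.
- by move=> s t sr tr; apply: fM; exact: zr.
- move=> s t sr tr; rewrite (helmholtz_eq _ hf (pD _ (zr s t sr tr))) normrN normrM gtr0_norm//.
  apply: (@le_lt_trans _ _ (lam * M)); last by rewrite ltrDl.
  by rewrite ler_pM2l//; apply: fM; exact: zr.
Qed.

Lemma near_open D x (P : R * R -> Prop) : open D -> D x ->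
  (forall y, D y -> P y) -> \forall y \near x, P y.
Proof. by move=> oD Dx H; apply: filterS (open_nbhs_nbhs (conj oD Dx)). Qed.

Lemma is_derive_comb f g x v a c k l :
  is_derive x v f k -> is_derive x v g l ->
  is_derive x v (fun y => a * f y + c * g y) (a * k + c * l).
Proof. by move=> df dg; exact: (is_deriveD (is_deriveZ a df) (is_deriveZ c dg)). Qed.

Lemma partial_comb D f g a c b x : helmholtz D f -> helmholtz D g -> D x ->
  partial b (fun y => a * f y + c * g y) x = a * partial b f x + c * partial b g x.
Proof.
move=> hf hg Dx; have [_ /(_ b)[df _] _] := hf x Dx; have [_ /(_ b)[dg _] _] := hg x Dx.
exact: partial_val (is_derive_comb a c (is_derive_partial df) (is_derive_partial dg)).
Qed.

Lemma helmholtz_comb D f g a c : open D -> helmholtz D f -> helmholtz D g ->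
  helmholtz D (fun y => a * f y + c * g y).
Proof.
move=> oD hf hg x Dx.
have D2 b : is_derive x (E b) (partial b (fun y => a * f y + c * g y))
    (a * partial b (partial b f) x + c * partial b (partial b g) x).
  have [_ /(_ b)[_ df] _] := hf x Dx; have [_ /(_ b)[_ dg] _] := hg x Dx.
  have := is_derive_comb a c (is_derive_partial df) (is_derive_partial dg).
  apply: near_eq_is_derive; apply: (near_open oD Dx) => y Dy.
  by rewrite (partial_comb _ _ _ hf hg Dy).
have [cf df lf] := hf x Dx; have [cg dg lg] := hg x Dx; split.
- exact: cvgD (cvgM (cvg_cst _) cf) (cvgM (cvg_cst _) cg).
- move=> b; split; last by case: (D2 b).
  by have [] := is_derive_comb a c (is_derive_partial (df b).1) (is_derive_partial (dg b).1).
- rewrite (partial_val (D2 true)) (partial_val (D2 false)).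
  have key (P P' Q Q' u v : R) : - (P + P') = lam * u -> - (Q + Q') = lam * v ->
      - (a * P + c * Q + (a * P' + c * Q')) = lam * (a * u + c * v).
    move=> hP hQ; rewrite (_ : lam * _ = a * (lam * u) + c * (lam * v)); last by ring.
    by rewrite -hP -hQ; ring.
  exact: key lf lg.
Qed.

Lemma derivable_translate f x y v :
  derivable f (x + y) v -> derivable (fun x => f (x + y)) x v.
Proof. by rewrite /derivable/=; under eq_fun do rewrite addrA. Qed.

Lemma helmholtz_translate D f y :
  helmholtz D f -> helmholtz [set x | D (x + y)] (fun x => f (x + y)).
Proof.
move=> hf x /= /hf [cf df lf]; split.
- apply: (@continuous_comp _ _ _ (fun x => x + y) f) => //.
  by apply: cvgD; [exact: cvg_id|exact: cvg_cst].
- move=> b; rewrite partial_translate.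
  by split; apply: derivable_translate; case: (df b).
- by rewrite !partial_translate.
Qed.

Definition diffq f b (h : R) x := h^-1 * (f (x + h *: E b) - f x).

Lemma diffqE f b h : diffq f b h =
  fun x => h^-1 * f (x + h *: E b) + (- h^-1) * f x.
Proof. by apply/funext => x; rewrite /diffq mulrBr mulNr. Qed.

(** The equation is linear with constant coefficients, so translates and combinations of solutions
    are solutions. *)
Lemma helmholtz_diffq D D' f b h : open D' -> D' `<=` D ->
  (forall x, D' x -> D (x + h *: E b)) ->
  helmholtz D f -> helmholtz D' (diffq f b h).
Proof.
move=> oD' DD' DD'' hf; rewrite diffqE; apply: helmholtz_comb => //.
  exact: helmholtz_sub (helmholtz_translate hf).
exact: helmholtz_sub hf.
Qed.

Lemma partial_diffq D f b c h x : helmholtz D f -> D x -> D (x + h *: E b) ->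
  partial c (diffq f b h) x = diffq (partial c f) b h x.
Proof.
move=> hf Dx Dxh; rewrite !diffqE.
have [_ /(_ c)[df _] _] := hf x Dx; have [_ /(_ c)[dg _] _] := hf _ Dxh.
have := is_derive_comb (h^-1) (- h^-1)
  (is_derive_partial (derivable_translate dg)) (is_derive_partial df).
by move=> /partial_val ->; rewrite partial_translate.
Qed.

(* The gradient estimate, applied to difference quotients of [f]. *)
Lemma grad_lipschitz D f p r M b c h : 0 < r -> open D ->
  (forall x, `|x - p| <= 3 * r -> D x) -> helmholtz D f ->
  (forall x, `|x - p| <= 3 * r -> `|f x| <= M) -> `|h| <= r ->
  `|partial c f (h *: E b + p) - partial c f p| <= `|h| * (grad_cst r ^+ 2 * M).
Proof.
move=> r0 oD pD hf fM hr.
have [->|h0] := eqVneq h 0; first by rewrite scale0r add0r subrr !normr0 mul0r.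
have tri x y k l : `|x - p| <= k -> `|y - x| <= l -> `|y - p| <= k + l.
  by have := ler_distD x y p; rewrite addrC => ? ? ?; lra.
have shift x t : `|t| <= r -> `|x + t *: E b - x| <= r.
  by move=> tr; rewrite addrAC subrr add0r normrZ norm_basis mulr1.
(* The radius [3 * r] is spent in thirds: one for this gradient bound, one for the shift by [h], one
   for the gradient bound of the quotient. *)
have df x : `|x - p| <= 2 * r -> `|partial b f x| <= grad_cst r * M.
  move=> xp; apply: (interior_gradient b r0 _ hf) => y xy; [apply: pD|apply: fM];
    have := tri _ _ _ _ xp xy; lra.
have pp : `|p - p| <= r by rewrite subrr normr0 ltW.
have hq : helmholtz (oball p (2 * r)) (diffq f b h).
  apply: (@helmholtz_diffq D) => //; first exact: open_oball.
    by move=> x; rewrite /oball/= => ?; apply: pD; lra.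
  move=> x; rewrite /oball/= => xp; apply: pD.
  have := tri _ _ _ _ (ltW xp) (shift x _ hr); lra.
have qM x : `|x - p| <= r -> `|diffq f b h x| <= grad_cst r * M.
  move=> xp; rewrite /diffq normrM normfV mulrC ler_pdivrMr ?normr_gt0//.
  have seg t : Num.min 0 h <= t <= Num.max 0 h -> `|t| <= r.
    case: (leP 0 h) => h0' /andP[x1 x2]; move: hr; rewrite !ler_norml; lra.
  have -> : f (x + h *: E b) - f x = f (h *: E b + x) - f (0 *: E b + x).
    by rewrite scale0r add0r [x + _]addrC.
  rewrite -{2}[h]subr0; apply: (@mvt_le R (fun t => f (t *: E b + x))
    (fun t => partial b f (t *: E b + x))).
    move=> t /seg tr; apply: (@is_derive_slice _ _ f _ x (E b)) => [//|].
    apply: is_derive_partial.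
    have Dtx : D (t *: E b + x).
      apply: pD; rewrite [_ + x]addrC; have := tri _ _ _ _ xp (shift x _ tr); lra.
    by have [_ /(_ b)[dfx _] _] := hf _ Dtx.
  move=> t /seg tr; apply: df; rewrite [_ + x]addrC.
  have := tri _ _ _ _ xp (shift x _ tr); lra.
have sub x : `|x - p| <= r -> oball p (2 * r) x by rewrite /oball/= => ?; lra.
have := interior_gradient c r0 sub hq qM.
rewrite (partial_diffq _ hf); last 2 first.
- by apply: pD; lra.
- by apply: pD; have := tri _ _ _ _ pp (shift p _ hr); lra.
rewrite /diffq normrM normfV mulrC ler_pdivrMr ?normr_gt0// [p + _]addrC.
by rewrite mulrA -expr2 [leRHS]mulrC.
Qed.

Lemma second_derive_bound D f p r M b : 0 < r -> open D ->
  (forall x, `|x - p| <= 3 * r -> D x) -> helmholtz D f ->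
  (forall x, `|x - p| <= 3 * r -> `|f x| <= M) ->
  `|partial b (partial b f) p| <= grad_cst r ^+ 2 * M.
Proof.
move=> r0 oD pD hf fM.
have [|_ /(_ b)[_ /is_derive_partial d2] _] := hf p.
  by apply: pD; rewrite subrr normr0 mulr_ge0// ltW.
apply: (derive_le_lipschitz r0 d2) => h hr.
exact: (grad_lipschitz b b r0 oD pD hf fM hr).
Qed.

End Helmholtz.

(** * Regularity: uniform limits and partial derivatives of solutions are solutions *)

Section HelmholtzRegularity.
Context {R : realType}.
Variable lam : R.
Hypothesis lam_gt0 : 0 < lam.
Implicit Types (D : set (R * R)) (f g : R * R -> R) (p x y : R * R).
Local Notation E := (@basis R).

Lemma cvg_seq_unique (u : nat -> R) (a b : R) :
  u @ \oo --> a -> u @ \oo --> b -> a = b.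
Proof. by move=> /(cvg_lim (@Rhausdorff R)) <- /(cvg_lim (@Rhausdorff R)). Qed.

Lemma second_partial_comb D f g a c b x : open D -> helmholtz lam D f ->
  helmholtz lam D g -> D x ->
  partial b (partial b (fun y => a * f y + c * g y)) x =
  a * partial b (partial b f) x + c * partial b (partial b g) x.
Proof.
move=> oD hf hg Dx; apply: partial_val.
have [_ /(_ b)[_ df] _] := hf x Dx; have [_ /(_ b)[_ dg] _] := hg x Dx.
apply: near_eq_is_derive (is_derive_comb a c (is_derive_partial df) (is_derive_partial dg)).
by apply: (near_open oD Dx) => y Dy; rewrite (partial_comb _ _ _ hf hg Dy).
Qed.

(** The difference [f_ n - f_ m] is itself a solution, of size at most [eps n + eps m], so the
    interior estimates apply to it. *)
Lemma uniform_derivative_bounds D (f_ : nat -> R * R -> R) f (eps : nat -> R) x :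
  open D -> D x -> (forall n, helmholtz lam D (f_ n)) ->
  (forall n y, D y -> `|f_ n y - f y| <= eps n) ->
  exists r, exists C1, exists C2, [/\ 0 < r,
    forall y, `|y - x| < r -> D y,
    forall b n m y, `|y - x| < r ->
      `|partial b (f_ n) y - partial b (f_ m) y| <= C1 * eps n + C1 * eps m &
    forall b n m y, `|y - x| < r ->
      `|partial b (partial b (f_ n)) y - partial b (partial b (f_ m)) y|
        <= C2 * eps n + C2 * eps m].
Proof.
move=> oD Dx hf fe; have [r0 r0_gt0 xD] := open_cball oD Dx.
(* A point [y] within [r] of [x] keeps the radius [3 * r] that [second_derive_bound] requires. *)
pose r := r0 / 4; have r_gt0 : 0 < r by rewrite divr_gt0.
have r0E : r0 = 4 * r by rewrite /r; field.
have yD y z : `|y - x| < r -> `|z - y| <= 3 * r -> D z.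
  by move=> yx zy; apply: xD; have := ler_distD y z x; rewrite r0E; lra.
have yD1 y z : `|y - x| < r -> `|z - y| <= r -> D z.
  by move=> yx zy; apply: (yD y) => //; lra.
have hg n m := helmholtz_comb 1 (-1) oD (hf n) (hf m).
have gM n m z : D z -> `|1 * f_ n z + -1 * f_ m z| <= eps n + eps m.
  move=> Dz; have := fe n z Dz; have := fe m z Dz.
  rewrite mul1r mulN1r [`|f_ m z - _|]distrC.
  have := ler_distD (f z) (f_ n z) (f_ m z); lra.
have yy y : `|y - x| < r -> D y.
  by move=> yx; apply: (yD y) => //; rewrite subrr normr0 mulr_ge0// ltW.
exists r, (grad_cst lam r), (grad_cst lam r ^+ 2); split=> //.
- move=> b n m y yx; rewrite -mulrDr.
  have := interior_gradient lam_gt0 b r_gt0 (fun z => yD1 y z yx) (hg n m)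
    (fun z zy => gM n m z (yD1 y z yx zy)).
  by rewrite (partial_comb _ _ _ (hf n) (hf m) (yy y yx)) mul1r mulN1r.
- move=> b n m y yx; rewrite -mulrDr.
  have := second_derive_bound lam_gt0 b r_gt0 oD (fun z => yD y z yx) (hg n m)
    (fun z zy => gM n m z (yD y z yx zy)).
  by rewrite (second_partial_comb _ _ _ oD (hf n) (hf m) (yy y yx)) mul1r mulN1r.
Qed.

Lemma scaled_cvg0 (eps : nat -> R) (C : R) :
  eps @ \oo --> 0 -> (fun n => C * eps n) @ \oo --> 0.
Proof. by move=> e0; rewrite -[0](mulr0 C); apply: cvgM => //; exact: cvg_cst. Qed.

(** By the previous bounds the first and second derivatives are locally uniformly Cauchy. Applying
    [derive_lim] along the axes, first to [f_ n] and then to its partial derivatives, differentiates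
    the limit twice, and the equation passes to the limit pointwise. *)
Lemma helmholtz_lim D (f_ : nat -> R * R -> R) f (eps : nat -> R) :
  open D -> eps @ \oo --> 0 -> (forall n, helmholtz lam D (f_ n)) ->
  (forall n y, D y -> `|f_ n y - f y| <= eps n) ->
  helmholtz lam D f /\
  forall b x, D x -> partial b (f_ n) x @[n --> \oo] --> partial b f x.
Proof.
move=> oD e0 hf fe.
have fcvg y : D y -> f_ n y @[n --> \oo] --> f y.
  move=> Dy; apply/cvgrPdist_lt => e egt0.
  move/cvgrPdist_lt : e0 => /(_ _ egt0) [N _ H]; exists N => // n /= Nn.
  rewrite distrC (le_lt_trans (fe n y Dy))// (le_lt_trans _ (H n Nn))//.
  by rewrite sub0r normrN ler_norm.
have line b x (t : R) : `|t *: E b + x - x| = `|t|.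
  by rewrite addrK normrZ norm_basis mulr1.
have D1 b x : D x -> derivable f x (E b) /\
    partial b (f_ n) x @[n --> \oo] --> partial b f x.
  move=> Dx; have [r [C1 [C2 [r0 xD B1 _]]]] := uniform_derivative_bounds oD Dx hf fe.
  have [||||l fl fd] := @derive_lim R (fun n t => f_ n (t *: E b + x))
    (fun n t => partial b (f_ n) (t *: E b + x)) (fun t => f (t *: E b + x))
    (fun n => C1 * eps n) r r0.
  - exact: scaled_cvg0.
  - move=> n t tr; have Dt : D (t *: E b + x) by apply: xD; rewrite line.
    apply: (@is_derive_slice _ _ (f_ n) _ x (E b)) => //.
    by have [_ /(_ b)[/is_derive_partial]] := hf n _ Dt.
  - by move=> n m t tr; apply: B1; rewrite line.
  - by move=> t tr; apply: fcvg; apply: xD; rewrite line.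
  have dfl : is_derive x (E b) f l.
    by rewrite -[x]add0r -(scale0r (E b)); apply/is_derive_line; rewrite add0r.
  rewrite (partial_val dfl); split; first by case: dfl.
  by rewrite scale0r add0r in fl.
have D2 b x : D x -> derivable (partial b f) x (E b) /\
    partial b (partial b (f_ n)) x @[n --> \oo] --> partial b (partial b f) x.
  move=> Dx; have [r [C1 [C2 [r0 xD _ B2]]]] := uniform_derivative_bounds oD Dx hf fe.
  have [||||l fl fd] := @derive_lim R (fun n t => partial b (f_ n) (t *: E b + x))
    (fun n t => partial b (partial b (f_ n)) (t *: E b + x))
    (fun t => partial b f (t *: E b + x))
    (fun n => C2 * eps n) r r0.
  - exact: scaled_cvg0.
  - move=> n t tr; have Dt : D (t *: E b + x) by apply: xD; rewrite line.
    apply: (@is_derive_slice _ _ (partial b (f_ n)) _ x (E b)) => //.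
    by have [_ /(_ b)[_ /is_derive_partial]] := hf n _ Dt.
  - by move=> n m t tr; apply: B2; rewrite line.
  - by move=> t tr; apply: (D1 b _ _).2; apply: xD; rewrite line.
  have dfl : is_derive x (E b) (partial b f) l.
    by rewrite -[x]add0r -(scale0r (E b)); apply/is_derive_line; rewrite add0r.
  rewrite (partial_val dfl); split; first by case: dfl.
  by rewrite scale0r add0r in fl.
split=> [x Dx|b x Dx]; last exact: (D1 b x Dx).2.
split.
- apply: (continuous_uniform_limit oD Dx e0 fe) => n.
  by have [] := hf n x Dx.
- by move=> b; split; [exact: (D1 b x Dx).1|exact: (D2 b x Dx).1].
- pose L n := - (partial true (partial true (f_ n)) x +
    partial false (partial false (f_ n)) x).
  have c1 : L @ \oo --> - (partial true (partial true f) x +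
      partial false (partial false f) x).
    exact: cvgN (cvgD (D2 true x Dx).2 (D2 false x Dx).2).
  have c2 : (fun n => lam * f_ n x) @ \oo --> lam * f x.
    exact: cvgM (cvg_cst lam) (fcvg x Dx).
  have LE : L = (fun n => lam * f_ n x).
    by apply/funext => n; have [_ _] := hf n x Dx.
  by apply: (cvg_seq_unique c1); rewrite LE.
Qed.

Lemma helmholtz_local D f :
  (forall x, D x -> exists2 D', D' x & helmholtz lam D' f) -> helmholtz lam D f.
Proof. by move=> H x /H[D' D'x]; apply. Qed.

(** The mean value inequality for [f] minus the linear function of slope [l] along the segment. *)
Lemma mvt_partial f b (a l C : R) y :
  (forall s, Num.min 0 a <= s <= Num.max 0 a ->
     derivable f (s *: E b + y) (E b) /\ `|partial b f (s *: E b + y) - l| <= C) ->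
  `|f (a *: E b + y) - f y - a * l| <= C * `|a|.
Proof.
move=> H.
have := @mvt_le R (fun s => f (s *: E b + y) - s * l)
  (fun s => partial b f (s *: E b + y) - l) 0 a C.
rewrite subr0 scale0r add0r mul0r subr0 addrAC; apply.
- move=> s /H[df _]; apply: is_deriveB.
    by apply: (@is_derive_slice _ _ f _ y (E b)) => //; exact: is_derive_partial.
  by apply: is_derive_ext (is_derive_quadratic 0 l 0 s) => [z|]; ring.
- by move=> s /H[].
Qed.

(** The partial derivative is Lipschitz by [grad_lipschitz], so the quotient differs from it by
    O(h). The constant is the same for all [x] near [p], giving the uniform error that
    [helmholtz_lim] takes as [eps]. *)
Lemma diffq_partial_close D f b p r M h x : 0 < r -> open D ->
  (forall y, `|y - p| <= 5 * r -> D y) -> helmholtz lam D f ->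
  (forall y, `|y - p| <= 5 * r -> `|f y| <= M) -> `|x - p| <= r ->
  0 < h <= r ->
  `|diffq f b h x - partial b f x| <= grad_cst lam r ^+ 2 * M * h.
Proof.
move=> r0 oD pD hf fM xp /andP[h0 hr].
pose C := grad_cst lam r ^+ 2 * M.
have tri y k : `|y - x| <= k -> `|y - p| <= k + r.
  by have := ler_distD x y p => ? ?; lra.
have line (t : R) : `|t *: E b + x - x| = `|t|.
  by rewrite addrK normrZ norm_basis mulr1.
have lip t : `|t| <= r -> `|partial b f (t *: E b + x) - partial b f x| <= `|t| * C.
  apply: (grad_lipschitz lam_gt0 b b r0 oD _ hf) => y yx; [apply: pD|apply: fM];
    have := tri _ _ yx; lra.
have -> : diffq f b h x - partial b f x =
    h^-1 * (f (h *: E b + x) - f x - h * partial b f x).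
  by rewrite /diffq [h *: _ + _]addrC; field; rewrite gt_eqF.
rewrite normrM normfV mulrC ler_pdivrMr ?normr_gt0 ?gt_eqF// -/C.
apply: mvt_partial => t.
rewrite (min_l (ltW h0)) (max_r (ltW h0)) => th.
have t0 : 0 <= t by lra.
have tr : `|t| <= r by rewrite ger0_norm//; lra.
have Dt : D (t *: E b + x).
  by apply: pD; have := tri (t *: E b + x) `|t|; rewrite line lexx => /(_ isT); lra.
have [_ /(_ b)[dft _] _] := hf _ Dt; split; first exact: dft.
apply: le_trans (lip t tr) _; rewrite ger0_norm// mulrC ler_wpM2l//; last lra.
rewrite mulr_ge0 ?sqr_ge0// (le_trans (normr_ge0 (f x)))// fM//; lra.
Qed.

(** On a small ball the difference quotients are solutions tending uniformly to [partial b f], so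
    [helmholtz_lim] applies. The convergence of their own partial derivatives is recorded too, as it
    yields the symmetry in [partialC]. *)
Lemma helmholtz_partial_cvg D f b x : open D -> helmholtz lam D f -> D x ->
  exists D', exists h_ : nat -> R,
  [/\ D' x, forall n, h_ n != 0, h_ @ \oo --> 0, helmholtz lam D' (partial b f) &
    forall c, diffq (partial c f) b (h_ n) x @[n --> \oo] --> partial c (partial b f) x].
Proof.
move=> oD hf Dx; have [r1 r1_gt0 xD] := open_cball oD Dx.
pose r := r1 / 5; have r_gt0 : 0 < r by rewrite divr_gt0.
have {}xD y : `|y - x| <= 5 * r -> D y.
  by move=> yx; apply: xD; rewrite /r in yx; lra.
have [M fM] : exists M, forall y, `|y - x| <= 5 * r -> `|f y| <= M.
  apply: bounded_on_cball; first lra.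
  by move=> y /xD/hf[].
(* The sequence [r / (n + 1)] tends to zero while staying in [(0, r]], as [diffq_partial_close]
   requires. *)
pose h_ n : R := r * harmonic n.
have h_gt0 n : 0 < h_ n by rewrite mulr_gt0// harmonic_gt0.
have h_le n : h_ n <= r.
  rewrite ler_piMr ?(ltW r_gt0)// /harmonic/=.
  by rewrite invr_le1 ?unitfE ?pnatr_eq0// ler1n.
have h_cvg : h_ @ \oo --> 0 by apply: scaled_cvg0; exact: cvg_harmonic.
pose D' := oball x r.
have DD' y : D' y -> D y by rewrite /D' /oball/= => ?; apply: xD; lra.
have DD'h n y : D' y -> D (y + h_ n *: E b).
  rewrite /D' /oball/= => yx; apply: xD; rewrite addrAC.
  apply: le_trans (ler_normD _ _) _.
  rewrite normrZ norm_basis mulr1 gtr0_norm//; have := h_le n; lra.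
have D'x : D' x by rewrite /D' /oball/= subrr normr0.
have [hp cp] := @helmholtz_lim D' (fun n => diffq f b (h_ n)) (partial b f)
  (fun n => grad_cst lam r ^+ 2 * M * h_ n) (@open_oball R x r) (scaled_cvg0 _ h_cvg)
  (fun n => helmholtz_diffq (@open_oball R x r) DD' (DD'h n) hf)
  (fun n y yD' => diffq_partial_close b r_gt0 oD xD hf fM (ltW yD')
     (introT andP (conj (h_gt0 n) (h_le n)))).
exists D', h_; split=> // [n|c]; first by rewrite gt_eqF.
apply: cvg_trans (cp c x D'x); apply: near_eq_cvg; apply: nearW => n.
by rewrite (partial_diffq _ hf)//; exact: DD'h.
Qed.

Lemma helmholtz_partial D f b : open D -> helmholtz lam D f ->
  helmholtz lam D (partial b f).
Proof.
move=> oD hf; apply: helmholtz_local => x Dx.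
by have [D' [_ [D'x _ _ hp _]]] := helmholtz_partial_cvg b oD hf Dx; exists D'.
Qed.

(** The quotients of [partial c f] in direction [b] tend to the left side by [helmholtz_partial_cvg]
    and to the right side by definition of the derivative. *)
Lemma partialC D f b c x : open D -> helmholtz lam D f -> D x ->
  partial c (partial b f) x = partial b (partial c f) x.
Proof.
move=> oD hf Dx.
have [D' [h_ [_ h0 h_cvg _ /(_ c) cv]]] := helmholtz_partial_cvg b oD hf Dx.
have [_ /(_ b)[dcf _] _] := helmholtz_partial c oD hf Dx.
apply: (cvg_seq_unique cv); apply/cvgrPdist_lt => e e0.
have /is_derive_epsP/(_ e e0)[d d0 H] := is_derive_partial dcf.
move/cvgrPdist_lt : h_cvg => /(_ _ d0); apply: filterS => n.
rewrite sub0r normrN => hd; rewrite distrC /diffq [x + _]addrC; exact: H.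
Qed.

(** The partial derivatives are solutions, hence continuous. The step from [x] to [x + h y] is made
    along the two axes in turn, with the mean value inequality on each leg. *)
Lemma is_derive_direction D f x y : open D -> helmholtz lam D f -> D x ->
  is_derive x y f (y.1 * partial true f x + y.2 * partial false f x).
Proof.
move=> oD hf Dx; apply/is_derive_epsP => e e0.
(* Each leg has length at most [|h| * N], and [(|y.1| + |y.2|) / (2 * N) < 1] makes the final bound
   strict; the summand 1 keeps [N] positive when [y = 0]. *)
pose N : R := 1 + `|y.1| + `|y.2|.
have N0 : 0 < N by rewrite /N -addrA ltr_pwDl// addr_ge0.
have e'0 : 0 < e / (2 * N) by rewrite divr_gt0// mulr_gt0.
have [d1 d1_gt0 H1] : exists2 d, 0 < d &
    forall z, `|z - x| < d -> forall b, D z /\ `|partial b f z - partial b f x| <= e / (2 * N).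
  have cp b : {for x, continuous (partial b f)}.
    by have [] := helmholtz_partial b oD hf Dx.
  have n0 : \forall z \near x, D z by exact: open_nbhs_nbhs.
  have nb b : \forall z \near x, `|partial b f x - partial b f z| <= e / (2 * N).
    by move/cvgrPdist_le : (cp b); apply.
  have /nbhs_ballP[d /= d0 H] : nbhs x [set z | D z /\ forall b,
      `|partial b f x - partial b f z| <= e / (2 * N)].
    by apply: filterS (filterI n0 (filterI (nb true) (nb false))) => z [Dz [zt zf]];
      split; [exact: Dz|case; [exact: zt|exact: zf]].
  exists d => // z zx b; have [|Dz zf] := H z.
    by rewrite -ball_normE/= distrC.
  by split=> //; rewrite distrC.
exists (d1 / N) => [|h h0]; first by rewrite divr_gt0.
rewrite ltr_pdivlMr// => hd.
have near_x s t : `|s| <= `|h * y.1| -> `|t| <= `|h * y.2| ->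
    `|s *: E true + (t *: E false + x) - x| < d1.
  move=> s1 t1; rewrite addrA addrK (norm_basis_lin false) gt_max.
  have hN z : `|z| <= N -> `|h * z| < d1.
    by move=> zN; apply: le_lt_trans hd; rewrite normrM ler_wpM2l.
  apply/andP; split.
    by apply: le_lt_trans s1 (hN _ _); rewrite /N; have := normr_ge0 y.2; lra.
  by apply: le_lt_trans t1 (hN _ _); rewrite /N; have := normr_ge0 y.1; lra.
have between (a s : R) : Num.min 0 a <= s <= Num.max 0 a -> `|s| <= `|a|.
  case: (leP 0 a) => a0 /andP[s1 s2].
    by rewrite !ger0_norm.
  by rewrite ler0_norm// ltr0_norm// lerN2.
have T1 := @mvt_partial f true (h * y.1) (partial true f x) (e / (2 * N))
  ((h * y.2) *: E false + x).
have T2 := @mvt_partial f false (h * y.2) (partial false f x) (e / (2 * N)) x.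
have {}T1 : `|f ((h * y.1) *: E true + ((h * y.2) *: E false + x))
    - f ((h * y.2) *: E false + x) - h * y.1 * partial true f x|
    <= e / (2 * N) * `|h * y.1|.
  apply: T1 => s /between sa; have [Dz ?] := H1 _ (near_x _ _ sa (lexx _)) true.
  by have [_ /(_ true)[dfz _] _] := hf _ Dz; split; [exact: dfz|].
have {}T2 : `|f ((h * y.2) *: E false + x) - f x - h * y.2 * partial false f x|
    <= e / (2 * N) * `|h * y.2|.
  apply: T2 => t /between ta.
  have := near_x 0 t; rewrite scale0r add0r normr0
    => /(_ (normr_ge0 _) ta) /H1/(_ false)[Dz ?].
  by have [_ /(_ false)[dfz _] _] := hf _ Dz; split; [exact: dfz|].
have yE : h *: y + x = (h * y.1) *: E true + ((h * y.2) *: E false + x).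
  rewrite addrA; congr (_ + _); case: y {N N0 e'0 H1 hd near_x T1 T2} => y1 y2 /=.
  rewrite /basis /e1 /e2; apply/pair_equal_spec; split=> /=;
    by rewrite ?[_ *: (0 : R)]mulr0 ?[_ *: (1 : R)]mulr1 ?addr0 ?add0r.
rewrite yE; move: T1 T2; set A := f (_ + _); set B := f (_ + _).
set p := partial true f x; set q := partial false f x => T1 T2.
have -> : h^-1 * (A - f x) - (y.1 * p + y.2 * q) =
    h^-1 * ((A - B - h * y.1 * p) + (B - f x - h * y.2 * q)) by field.
rewrite normrM normfV mulrC ltr_pdivrMr ?normr_gt0//.
apply: le_lt_trans (ler_normD _ _) _; apply: le_lt_trans (lerD T1 T2) _.
rewrite -mulrDr !normrM -mulrDr mulrCA mulrA.
have -> : `|h| * (e / (2 * N)) * (`|y.1| + `|y.2|) =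
    (e * `|h|) * ((`|y.1| + `|y.2|) / (2 * N)).
  by field; rewrite gt_eqF.
rewrite gtr_pMr ?mulr_gt0 ?normr_gt0//.
rewrite ltr_pdivrMr ?mulr_gt0// mul1r /N.
by move: (normr_ge0 y.1) (normr_ge0 y.2); clear; lra.
Qed.

(** * Derivatives of all orders, mixed and along lines *)

Lemma helmholtz_iter_partial D f b n : open D -> helmholtz lam D f ->
  helmholtz lam D (iter n (partial b) f).
Proof. by move=> oD hf; elim: n => //= n; exact: helmholtz_partial. Qed.

Lemma partial_iterC D f n x : open D -> helmholtz lam D f -> D x ->
  partial false (iter n (partial true) f) x = iter n (partial true) (partial false f) x.
Proof.
move=> oD hf; elim: n x => //= n IHn x Dx.
rewrite (partialC _ _ oD (helmholtz_iter_partial true n oD hf) Dx).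
exact: eq_partial oD Dx IHn.
Qed.

Definition mixed f (x : R * R) (j k : nat) : R :=
  iter j (partial true) (iter k (partial false) f) x.

(* [directional c s a m j k] is [(c X + s Y)^m X^j Y^k] with each monomial
   [X^j Y^k] read as [a j k]. *)
Fixpoint directional (c s : R) (a : nat -> nat -> R) (m j k : nat) : R :=
  if m is m'.+1 then
    c * directional c s a m' j.+1 k + s * directional c s a m' j k.+1
  else a j k.

Lemma is_derive_directional D f x y m j k : open D -> helmholtz lam D f -> D x ->
  is_derive x y (fun z => directional y.1 y.2 (mixed f z) m j k)
    (directional y.1 y.2 (mixed f x) m.+1 j k).
Proof.
move=> oD hf Dx; elim: m j k => [|m IHm] j k /=; last exact: is_derive_comb.
have hk := helmholtz_iter_partial false k oD hf.
have := is_derive_direction y oD (helmholtz_iter_partial true j oD hk) Dx.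
by rewrite (partial_iterC j oD hk Dx).
Qed.

Lemma is_derive_directional_line D f x y (t : R) m : open D -> helmholtz lam D f ->
  D (x + t *: y) ->
  is_derive t 1 (fun s => directional y.1 y.2 (mixed f (x + s *: y)) m 0 0)
    (directional y.1 y.2 (mixed f (x + t *: y)) m.+1 0 0).
Proof.
move=> oD hf; rewrite addrC => Dt.
apply: (@is_derive_slice _ _ (fun z => directional y.1 y.2 (mixed f z) m 0 0) _ x y) => [s|].
  by rewrite addrC.
exact: is_derive_directional oD hf Dt.
Qed.

(** The link with [taylor_hom]: every homogeneous Taylor term at [x] is a combination of the numbers
    [mixed f x j k]. *)
Lemma derive1n_directional D f x y (t : R) m : open D -> helmholtz lam D f ->
  D (x + t *: y) ->
  derive1n m (fun s : R => f (x + s *: y)) t =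
  directional y.1 y.2 (mixed f (x + t *: y)) m 0 0.
Proof.
move=> oD hf; elim: m t => [//|m IHm] t Dt; rewrite derive1nS derive1E.
have [_ <-] := is_derive_directional_line m oD hf Dt.
apply: near_eq_derive.
have ct : {for t, continuous (fun s : R => x + s *: y)}.
  by apply: cvgD; [exact: cvg_cst|apply: cvgZr_tmp; exact: cvg_id].
have nD : nbhs (x + t *: y) D by exact: open_nbhs_nbhs.
have : \forall s \near t, D (x + s *: y) := ct D nD.
by apply: filterS => s; exact: IHm.
Qed.

(** By induction on [m]: each derivative vanishes at [t] because the preceding one vanishes on
    [[t, r)]. This includes the vertex [t = 0]. *)
Lemma directional_ray D f x y (r t : R) m : open D -> helmholtz lam D f ->
  (forall s, 0 <= s < r -> D (x + s *: y)) ->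
  (forall s, 0 <= s < r -> f (x + s *: y) = 0) ->
  0 <= t < r -> directional y.1 y.2 (mixed f (x + t *: y)) m 0 0 = 0.
Proof.
move=> oD hf sD f0; elim: m t => [|m IHm] t tr; first exact: f0.
have rt : 0 < r - t by lra.
apply: (derive_eq0_right rt (is_derive_directional_line m oD hf (sD t tr))) => s sr.
by apply: IHm; lra.
Qed.

(** In operator form the equation is [Y^2 = - X^2 - lam]; it is applied to the solution [X^j Y^k f]
    after commuting the derivatives. *)
Lemma mixed_helmholtz D f x j k : open D -> helmholtz lam D f -> D x ->
  mixed f x j k.+2 = - mixed f x j.+2 k - lam * mixed f x j k.
Proof.
move=> oD hf Dx; have hk := helmholtz_iter_partial false k oD hf.
have hj := helmholtz_iter_partial true j oD hk.
have hkS := helmholtz_partial false oD hk.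
have -> : mixed f x j k.+2 = partial false (partial false
    (iter j (partial true) (iter k (partial false) f))) x.
  rewrite /mixed -[LHS]/(iter j (partial true)
    (partial false (partial false (iter k (partial false) f))) x).
  rewrite -(partial_iterC j oD hkS Dx).
  apply: (eq_partial false oD Dx) => y Dy.
  by rewrite (partial_iterC j oD hk Dy).
have key (A B C : R) : A + B = - C -> A = - B - C by move=> ?; lra.
exact: key (helmholtz_eq true hj Dx).
Qed.

End HelmholtzRegularity.

(** * The lowest-order term along two directions *)

Section LowestOrderTerm.
Context {R : realType}.

(** Removing the whole multiples of [pi] changes [sin] at most in sign and leaves a zero in
    [[0, pi)], which is 0 since [sin] is positive on [(0, pi)]. *)
Lemma sin_eq0_nat (x : R) : 0 <= x -> sin x = 0 -> exists n : nat, x = n%:R * pi.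
Proof.
move=> x0 sx0; have pi0 := pi_gt0 R.
pose n := Num.truncn (x / pi); exists n; pose y := x - n%:R * pi.
have /andP[n1 n2] := truncn_itv (divr_ge0 x0 (ltW pi0)).
have y0 : 0 <= y by rewrite subr_ge0 -ler_pdivlMr.
have ypi : y < pi.
  rewrite ltrBlDr; have : x < n.+1%:R * pi by rewrite -ltr_pdivrMr.
  by rewrite -natr1 mulrDl mul1r addrC.
have sy0 : sin y = 0.
  have := alternatingn (@sinDpi R) n y.
  rewrite -mulr_natl subrK sx0 => /esym/eqP.
  by rewrite mulf_eq0 signr_eq0 => /eqP.
apply/eqP; rewrite -subr_eq0 -/y eq_le y0 andbT leNgt; apply/negP => ygt0.
by have := @sin_gt0_pi R y; rewrite sy0 ltxx ygt0 ypi => /(_ isT).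
Qed.

(** When all lower orders vanish, the term in [lam] drops out and [Y^2 = - X^2]: [Y] acts as [i X].
    The formula is then de Moivre's, [(cos phi X + sin phi Y)^n = X^(n-1) (cos (n phi) X + sin (n
    phi) Y)]. *)
Lemma directional_polar (a : nat -> nat -> R) (lam phi : R) n :
  (forall j k, a j k.+2 = - a j.+2 k - lam * a j k) ->
  (forall j k, (j + k < n)%N -> a j k = 0) ->
  forall m j k, (j + k + m.+1 = n)%N ->
  directional (cos phi) (sin phi) a m.+1 j k =
  cos (m.+1%:R * phi) * a (j + m.+1)%N k + sin (m.+1%:R * phi) * a (j + m)%N k.+1.
Proof.
move=> rec low; elim=> [|m IHm] j k jkn.
  by rewrite /= mul1r addn1 addn0.
rewrite -[LHS]/(cos phi * directional (cos phi) (sin phi) a m.+1 j.+1 k +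
  sin phi * directional (cos phi) (sin phi) a m.+1 j k.+1).
rewrite IHm; last lia.
rewrite IHm; last lia.
rewrite rec (low (j + m)%N k); last lia.
have -> : m.+2%:R * phi = m.+1%:R * phi + phi by rewrite -[m.+2]addn1 natrD mulrDl mul1r.
by rewrite cosD sinD !addSn !addnS; ring.
Qed.

Lemma directional_eq0 (a : nat -> nat -> R) (c s : R) m j k :
  (forall j k, a j k = 0) -> directional c s a m j k = 0.
Proof. by move=> a0; elim: m j k => //= m IHm j k; rewrite !IHm !mulr0 addr0. Qed.

(** Induction on the order [j + k]. The two directions give a linear system in the coefficients of
    [X^n] and [X^(n-1) Y] with determinant [sin (n (psi - phi))]; the recurrence reduces the other
    coefficients of order [n] to these two. *)
Lemma two_directions_vanish (a : nat -> nat -> R) (lam phi psi : R) :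
  (forall j k, a j k.+2 = - a j.+2 k - lam * a j k) ->
  (forall m, directional (cos phi) (sin phi) a m 0 0 = 0) ->
  (forall m, directional (cos psi) (sin psi) a m 0 0 = 0) ->
  (forall m : nat, sin (m.+1%:R * (psi - phi)) != 0) ->
  forall j k, a j k = 0.
Proof.
move=> rec phi0 psi0 sin0.
suff H n : forall j k, (j + k < n)%N -> a j k = 0.
  by move=> j k; exact: (H (j + k).+1).
elim: n => // n IHn j k; rewrite ltnS leq_eqVlt => /orP[/eqP jkn|]; last exact: IHn.
case: n => [|n] in IHn jkn *.
  by case: j k jkn => [|//] [|//] _; exact: (phi0 0%N).
have := phi0 n.+1; rewrite (directional_polar _ rec IHn)// !add0n.
have := psi0 n.+1; rewrite (directional_polar _ rec IHn)// !add0n.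
set A := a n.+1 0; set B := a n 1 => Epsi Ephi.
have S := sin0 n; rewrite mulrBr sinB in S.
(* Cramer's rule: the determinant times each unknown is a combination of the two vanishing
   expressions. *)
have A0 : A = 0.
  apply/eqP; rewrite -(mulrI_eq0 _ (mulfI S)); apply/eqP.
  rewrite (_ : _ * A =
    sin (n.+1%:R * psi) * (cos (n.+1%:R * phi) * A + sin (n.+1%:R * phi) * B)
    - sin (n.+1%:R * phi) * (cos (n.+1%:R * psi) * A + sin (n.+1%:R * psi) * B)); last by ring.
  by rewrite Ephi Epsi !mulr0 subrr.
have B0 : B = 0.
  apply/eqP; rewrite -(mulrI_eq0 _ (mulfI S)); apply/eqP.
  rewrite (_ : _ * B =
    cos (n.+1%:R * phi) * (cos (n.+1%:R * psi) * A + sin (n.+1%:R * psi) * B)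
    - cos (n.+1%:R * psi) * (cos (n.+1%:R * phi) * A + sin (n.+1%:R * phi) * B)); last by ring.
  by rewrite Ephi Epsi !mulr0 subrr.
(* The recurrence lowers [k] by two at fixed order, so the base cases are [k = 0] and [k = 1], that
   is [A] and [B]. *)
have [l] := ubnP k; elim: l => // l IHl in j k jkn *; rewrite ltnS => kl.
case: k => [|[|k]] in jkn kl *.
- by rewrite addn0 in jkn; rewrite jkn.
- by move: jkn; rewrite addn1 => -[->].
rewrite rec (IHl j.+2 k); [|lia|lia].
by rewrite (IHn j k); [rewrite mulr0 !oppr0 addr0|lia].
Qed.

End LowestOrderTerm.

Theorem theorem2p1 (R : realType) (Omega : set (R * R)) (lambda : R)
  (u : R * R -> R) (x0 : R * R) (th r1 r2 alpha : R) :
  open Omega ->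
  0 < lambda ->
  in_L2 Omega u ->
  C2_on Omega u ->
  (forall x, Omega x -> - laplacian u x = lambda * u x) ->
  Omega x0 ->
  0 < r1 -> 0 < r2 ->
  (* Gamma+ and Gamma- : segments issued from x0, the angle from Gamma+ to
     Gamma- at x0 being alpha * 2 pi *)
  segment_from x0 th r1 `<=` Omega ->
  segment_from x0 (th + alpha * (2 * pi)) r2 `<=` Omega ->
  segment_from x0 th r1 `&` segment_from x0 (th + alpha * (2 * pi)) r2 = [set x0] ->
  (* they are nodal lines of u *)
  (forall x, segment_from x0 th r1 x -> u x = 0) ->
  (forall x, segment_from x0 (th + alpha * (2 * pi)) r2 x -> u x = 0) ->
  0 < alpha < 1 ->
  irrational alpha ->
  Vani u x0 = +oo%E.
Proof.
move=> oO lam0 _ C2 eqn Ox0 r1_gt0 r2_gt0 s1 s2 _ u1 u2 /andP[a0 _] irr.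
have hu := C2_helmholtz C2 eqn.
have mem phi (r s : R) : 0 <= s < r -> segment_from x0 phi r (x0 + s *: dir phi).
  by move=> /andP[s0 sr]; exists s => //=; rewrite in_itv/= s0 ltW.
have ray phi (r : R) m : 0 < r -> segment_from x0 phi r `<=` Omega ->
    (forall x, segment_from x0 phi r x -> u x = 0) ->
    directional (cos phi) (sin phi) (mixed u x0) m 0 0 = 0.
  move=> r0 sO su.
  have := @directional_ray R lambda lam0 Omega u x0 (dir phi) r 0 m oO hu.
  rewrite scale0r addr0; apply.
  - by move=> s /(mem phi)/sO.
  - by move=> s /(mem phi)/su.
  - by rewrite lexx.
have flat : forall j k, mixed u x0 j k = 0.
  apply: (@two_directions_vanish R _ lambda th (th + alpha * (2 * pi))).
  - by move=> j k; exact: (mixed_helmholtz lam0 j k oO hu Ox0).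
  - by move=> m; exact: (ray _ _ m r1_gt0 s1 u1).
  - by move=> m; exact: (ray _ _ m r2_gt0 s2 u2).
  - move=> m; rewrite addrAC subrr add0r; apply/eqP => /sin_eq0_nat[|n].
      by rewrite !mulr_ge0 ?(ltW a0)// pi_ge0.
    (* From [(m + 1) * alpha * 2 * pi = n * pi] follows [alpha = n / (2 (m + 1))], which is
       rational. *)
    move=> E; apply: irr; apply/rationalP; exists n%:Z, (2 * m.+1)%N.
    have pi0 : pi != 0 :> R by rewrite gt_eqF// pi_gt0.
    have m0 : m.+1%:R != 0 :> R by rewrite pnatr_eq0.
    rewrite -pmulrn natrM; apply: (mulIf pi0); rewrite mulrAC -E.
    by field.
(* A nonzero Taylor term would be a combination of the derivatives in [flat], all zero; hence the
   [+oo] branch. *)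
rewrite /Vani; case: pselect => // h; exfalso; case: h => m /asboolP[y].
rewrite /taylor_hom (derive1n_directional lam0 _ oO hu); last by rewrite scale0r addr0.
by rewrite scale0r addr0 directional_eq0// mul0r eqxx.
Qed.
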